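(* The problem \textsc{Partial VC Dimension} is solvable in time $O((|X|+|E|)^{\min\{k,\ell\}+O(1)})$; consequently, \textsc{Partial VC Dimension} parameterized by $k$ (or by $\ell$) belongs to the class XP.
   Context: A hypergraph $H=(X,E)$ consists of a finite vertex set $X$ and a collection $E$ of subsets of $X$. For $C\subseteq X$, the number of (neighborhood) equivalence classes induced by $C$ is $|\{e\cap C: e\in E\}|$. \textsc{Partial VC Dimension}: given a hypergraph $H=(X,E)$ and integers $k,\ell$, decide whether there is a set $C\subseteq X$ of size $k$ inducing at least $\ell$ distinct equivalence classes. XP is the class of parameterized problems solvable in time $|I|^{f(p)}$ for instance $I$, parameter $p$ and computable $f$. *)

(* Defs.v *)
From mathcomp Require Import all_boot.
Set Implicit Arguments. Unset Strict Implicit. Unset Printing Implicit Defensive.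

(* A hypergraph on the vertex set X = 'I_n, with hyperedge list E
   (|X| = n, |E| = size E). *)

Definition n_classes (n : nat) (E : seq {set 'I_n}) (C : {set 'I_n}) : nat :=
  #|[set e :&: C | e in E]|.

Definition partial_vc (n : nat) (E : seq {set 'I_n}) (k l : nat) : Prop :=
  exists C : {set 'I_n}, #|C| = k /\ l <= n_classes E C.

Inductive instr : Type :=
| IConst of nat & nat
| IAdd of nat & nat & nat
| ISub of nat & nat & nat
| ILoad of nat & nat
| IStore of nat & nat
| IJz of nat & nat
| IHalt.

Definition program := seq instr.
Definition regs := nat -> nat.

Definition upd (r : regs) (i v : nat) : regs := fun j => if j == i then v else r j.

(* One step; None means the machine has halted (IHalt, or pc out of range). *)
Definition step (p : program) (s : nat * regs) : option (nat * regs) :=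
  let: (pc, r) := s in
  match nth IHalt p pc with
  | IConst d v => Some (pc.+1, upd r d v)
  | IAdd d a b => Some (pc.+1, upd r d (r a + r b))
  | ISub d a b => Some (pc.+1, upd r d (r a - r b))
  | ILoad d a => Some (pc.+1, upd r d (r (r a)))
  | IStore a s => Some (pc.+1, upd r (r a) (r s))
  | IJz a t => Some (if r a == 0 then t else pc.+1, r)
  | IHalt => None
  end.

Fixpoint exec (p : program) (t : nat) (s : nat * regs) : option regs :=
  match step p s with
  | None => Some s.2
  | Some s' => if t is t'.+1 then exec p t' s' else None
  end.

(* Input encoding of an instance (H = ('I_n, E), k, l):
   r_0 = |X|, r_1 = |E|, r_2 = k, r_3 = l, and the incidence matrix
   r_(4 + i*|X| + x) = [x \in E_i] for i < |E|, x < |X|; all other registers 0. *)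
Definition incid (n : nat) (E : seq {set 'I_n}) (i x : nat) : nat :=
  [exists y : 'I_n, (val y == x) && (y \in nth set0 E i)].

Definition init_regs (n : nat) (E : seq {set 'I_n}) (k l : nat) : regs :=
  fun j =>
    if j == 0 then n else if j == 1 then size E else if j == 2 then k
    else if j == 3 then l
    else if (4 <= j) && (j - 4 < size E * n)
         then incid E ((j - 4) %/ n) ((j - 4) %% n) else 0.

Definition inst_size (n : nat) (E : seq {set 'I_n}) : nat := n + size E.

Definition decides_within (p : program)
    (T : forall n : nat, seq {set 'I_n} -> nat -> nat -> nat) : Prop :=
  forall (n : nat) (E : seq {set 'I_n}) (k l : nat),
    exists r : regs, exec p (T n E k l) (0, init_regs E k l) = Some r /\
      (r 0 != 0 <-> partial_vc E k l).

(* XP membership w.r.t. a parameter: time |I|^(f(param)) for some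
   (Rocq-definable, hence computable) f; |I| is floored at 2 to avoid 0^d, 1^d. *)
Definition in_XP (param : forall n : nat, seq {set 'I_n} -> nat -> nat -> nat) : Prop :=
  exists (p : program) (f : nat -> nat),
    decides_within p (fun n E k l => (maxn 2 (inst_size E)) ^ (f (param n E k l))).

(* Main.v *)
Require Import Defs.
From mathcomp Require Import all_boot.
From mathcomp Require Import zify.
Set Implicit Arguments. Unset Strict Implicit. Unset Printing Implicit Defensive.

(** Bondy's argument shows that [l] classes can always be induced by at most [l]
    vertices, and classes only increase when vertices are added.  Hence the answer
    is yes iff [k <= |X|] and some [min k l]-tuple of vertices (repetitions allowed)
    induces [l] classes.  The machine runs through the [|X| ^ min k l] tuples with
    an odometer and counts, for each of them, the hyperedges whose trace differs
    from all earlier traces, in time [O(|E|^2 * min k l)].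

    The input leaves the machine no free register: the incidence matrix starts at
    address 4.  The six matrix bits in registers 4 to 9 are therefore first packed
    into register 0 as low-order binary digits, which frees enough registers to copy
    the matrix to a higher address and to unpack the bits there. *)

(** * A structured language compiled to the machine *)

(* [While] jumps back through register 4, which it sets to 0. *)
Inductive cmd : Type :=
| Cst of nat & nat
| Plus of nat & nat & nat
| Minus of nat & nat & nat
| Get of nat & nat
| Put of nat & nat
| Seq of cmd & cmd
| When of nat & cmd
| While of nat & cmd.

Notation "c1 ;; c2" := (Seq c1 c2) (at level 85, right associativity).

(** The machine jumps to absolute addresses, so [o] records where the code will be placed. *)
Fixpoint compile (o : nat) (c : cmd) : program :=
  match c with
  | Cst d v => [:: IConst d v]
  | Plus d a b => [:: IAdd d a b]
  | Minus d a b => [:: ISub d a b]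
  | Get d a => [:: ILoad d a]
  | Put a s => [:: IStore a s]
  | Seq c1 c2 =>
      let p1 := compile o c1 in p1 ++ compile (o + size p1) c2
  | When a c1 =>
      let p1 := compile o.+1 c1 in IJz a (o + size p1).+1 :: p1
  | While a c1 =>
      let p1 := compile o.+1 c1 in
      IJz a (o + size p1 + 3) :: p1 ++ [:: IConst 4 0; IJz 4 o]
  end.

(** Big-step semantics with the exact number of machine steps. A round of [While] costs three steps
    besides its body: the test, the reset of register 4 and the jump back, so the next round starts
    from [upd r1 4 0]. *)
Inductive run : cmd -> regs -> nat -> regs -> Prop :=
| run_const d v r : run (Cst d v) r 1 (upd r d v)
| run_add d a b r : run (Plus d a b) r 1 (upd r d (r a + r b))
| run_sub d a b r : run (Minus d a b) r 1 (upd r d (r a - r b))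
| run_load d a r : run (Get d a) r 1 (upd r d (r (r a)))
| run_store a s r : run (Put a s) r 1 (upd r (r a) (r s))
| run_seq c1 c2 r t1 r1 t2 r2 :
    run c1 r t1 r1 -> run c2 r1 t2 r2 -> run (c1 ;; c2) r (t1 + t2) r2
| run_when_skip a c r : r a = 0 -> run (When a c) r 1 r
| run_when a c r t r' : r a != 0 -> run c r t r' -> run (When a c) r t.+1 r'
| run_while_end a c r : r a = 0 -> run (While a c) r 1 r
| run_while a c r t1 r1 t2 r2 :
    r a != 0 -> run c r t1 r1 -> run (While a c) (upd r1 4 0) t2 r2 ->
    run (While a c) r (t1 + t2 + 3) r2.

Lemma exec_step (p : program) t pc r s :
  step p (pc, r) = Some s -> exec p t.+1 (pc, r) = exec p t s.
Proof. by move=> /= ->. Qed.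

Lemma nth_mid (p1 p2 : program) i : nth IHalt (p1 ++ i :: p2) (size p1) = i.
Proof. by rewrite nth_cat ltnn subnn. Qed.

(** Surrounding code and leftover fuel [t0] are arbitrary, so that the induction hypothesis for a
    subcommand applies with its neighbours moved into [p1] or [p2]. *)
Lemma compile_correct c r t r' : run c r t r' ->
  forall p1 p2 t0,
    let p := p1 ++ compile (size p1) c ++ p2 in
    exec p (t + t0) (size p1, r) =
    exec p t0 (size p1 + size (compile (size p1) c), r').
Proof.
elim=> {c r t r'}.
1-5: by move=> * /=; rewrite nth_mid addn1.
- move=> c1 c2 r t1 r1 t2 r2 _ IH1 _ IH2 p1 p2 t0 /=.
  have := IH1 p1 (compile (size p1 + size (compile (size p1) c1)) c2 ++ p2) (t2 + t0).
  rewrite -!catA addnA => ->.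
  have := IH2 (p1 ++ compile (size p1) c1) p2 t0.
  by rewrite !size_cat -!catA addnA.
- move=> a c r ra p1 p2 t0 p; rewrite /p /= nth_mid ra /=.
  by rewrite addnS.
- move=> a c r t r' ra _ IH p1 p2 t0 /=.
  rewrite nth_mid (negbTE ra).
  have := IH (rcons p1 (IJz a (size p1 + size (compile (size p1).+1 c)).+1)) p2 t0.
  by rewrite !size_rcons cat_rcons addSnnS.
- move=> a c r ra p1 p2 t0 p; rewrite /p /= nth_mid ra /=.
  by rewrite size_cat /= add0n; congr (exec _ _ (_, _)); lia.
- move=> a c r t1 r1 t2 r2 ra _ IH1 _ IH2 p1 p2 t0 /=.
  set q := compile _ c.
  set J := IJz a _.
  set p := p1 ++ _.
  (* One step for the test, [t1] for the body, two for reset and jump; the loop head is then reached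
     again with fuel [t2 + t0]. *)
  have -> : t1 + t2 + 3 + t0 = (t1 + (t2 + t0).+2).+1 by lia.
  rewrite (@exec_step _ _ _ _ ((size p1).+1, r)); last first.
    by rewrite /step nth_mid /J (negbTE ra).
  have := IH1 (rcons p1 J) ([:: IConst 4 0; IJz 4 (size p1)] ++ p2) (t2 + t0).+2.
  have -> : rcons p1 J ++ compile (size (rcons p1 J)) c ++
     [:: IConst 4 0; IJz 4 (size p1)] ++ p2 = p.
    by rewrite /p size_rcons cat_rcons /q /= -!catA.
  rewrite size_rcons -/q => ->.
  rewrite (@exec_step _ _ _ _ (((size p1).+1 + size q).+1, upd r1 4 0)); last first.
    have -> : p = (rcons p1 J ++ q) ++ [:: IConst 4 0, IJz 4 (size p1) & p2].
      by rewrite /p cat_rcons /= -!catA.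
    have -> : (size p1).+1 + size q = size (rcons p1 J ++ q).
      by rewrite size_cat size_rcons.
    by rewrite /step nth_mid.
  rewrite (@exec_step _ _ _ _ (size p1, upd r1 4 0)); last first.
    have -> : p = (rcons (rcons p1 J ++ q) (IConst 4 0)) ++ IJz 4 (size p1) :: p2.
      by rewrite /p cat_rcons cat_rcons /= -!catA.
    have -> : ((size p1).+1 + size q).+1 = size (rcons (rcons p1 J ++ q) (IConst 4 0)).
      by rewrite size_rcons size_cat size_rcons.
    by rewrite /step nth_mid /upd eqxx.
  by have := IH2 p1 p2 t0.
Qed.

Lemma exec_mono p t t' s r : exec p t s = Some r -> t <= t' -> exec p t' s = Some r.
Proof.
elim: t t' s => [|t IH] t' s.
  by case: t' => [|t'] /=; case: (step p s).
by case: t' => //= t'; case: (step p s) => // s' H /IH; apply.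
Qed.

Lemma compile_exec c r t r' T :
  run c r t r' -> t <= T -> exec (compile 0 c) T (0, r) = Some r'.
Proof.
move=> H; apply: exec_mono.
have := compile_correct H [::] [::] 0.
rewrite /= cats0 addn0 add0n => ->.
(* The program counter is just past the code, where [nth] defaults to [IHalt], so the machine halts
   without further fuel. *)
by rewrite /= nth_default.
Qed.

(* Total correctness; the postcondition also sees the running time. *)
Definition wp (c : cmd) (r : regs) (Q : nat -> regs -> Prop) : Prop :=
  exists t r', run c r t r' /\ Q t r'.

Lemma wp_conseq c r (Q Q' : nat -> regs -> Prop) :
  wp c r Q -> (forall t r', Q t r' -> Q' t r') -> wp c r Q'.
Proof. by move=> [t [r' [H1 H2]]] H; exists t, r'; split=> //; apply: H. Qed.

(* Naming the assigned value keeps the state terms small. *)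
Lemma wp_const d v r (Q : nat -> regs -> Prop) : Q 1 (upd r d v) -> wp (Cst d v) r Q.
Proof. by exists 1, (upd r d v); split=> //; constructor. Qed.

Lemma wp_add d a b r (Q : nat -> regs -> Prop) :
  (forall v, v = r a + r b -> Q 1 (upd r d v)) -> wp (Plus d a b) r Q.
Proof. by move=> H; exists 1, (upd r d (r a + r b)); split; [constructor | exact: H]. Qed.

Lemma wp_sub d a b r (Q : nat -> regs -> Prop) :
  (forall v, v = r a - r b -> Q 1 (upd r d v)) -> wp (Minus d a b) r Q.
Proof. by move=> H; exists 1, (upd r d (r a - r b)); split; [constructor | exact: H]. Qed.

Lemma wp_load d a r (Q : nat -> regs -> Prop) :
  (forall v, v = r (r a) -> Q 1 (upd r d v)) -> wp (Get d a) r Q.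
Proof. by move=> H; exists 1, (upd r d (r (r a))); split; [constructor | exact: H]. Qed.

Lemma wp_store a s r (Q : nat -> regs -> Prop) :
  (forall i v, i = r a -> v = r s -> Q 1 (upd r i v)) -> wp (Put a s) r Q.
Proof. by move=> H; exists 1, (upd r (r a) (r s)); split; [constructor | exact: H]. Qed.

Lemma wp_seq c1 c2 r Q :
  wp c1 r (fun t1 r1 => wp c2 r1 (fun t2 r2 => Q (t1 + t2) r2)) -> wp (c1 ;; c2) r Q.
Proof.
move=> [t1 [r1 [H1 [t2 [r2 [H2 HQ]]]]]].
by exists (t1 + t2), r2; split=> //; apply: run_seq H2.
Qed.

Lemma wp_when a c r (Q : nat -> regs -> Prop) :
  (r a = 0 -> Q 1 r) -> (r a != 0 -> wp c r (fun t => Q t.+1)) -> wp (When a c) r Q.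
Proof.
case: (eqVneq (r a) 0) => ra H1 H2.
  by exists 1, r; split; [constructor | apply: H1].
have [t [r' [H HQ]]] := H2 isT.
by exists t.+1, r'; split=> //; constructor.
Qed.

Lemma wp_while a c r (Q : nat -> regs -> Prop) :
  (r a = 0 -> Q 1 r) ->
  (r a != 0 -> wp c r (fun t1 r1 => wp (While a c) (upd r1 4 0)
                                     (fun t2 => Q (t1 + t2 + 3)))) ->
  wp (While a c) r Q.
Proof.
case: (eqVneq (r a) 0) => ra H1 H2.
  by exists 1, r; split; [constructor | apply: H1].
have [t1 [r1 [R1 [t2 [r2 [R2 HQ]]]]]] := H2 isT.
by exists (t1 + t2 + 3), r2; split=> //; apply: run_while R2.
Qed.

(** * Symbolic execution and frame conditions *)

Definition Mov d s := Cst d 0 ;; Plus d d s.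

Lemma upd_eq r i v : upd r i v i = v.
Proof. by rewrite /upd eqxx. Qed.

Lemma upd_ne r i v j : j != i -> upd r i v j = r j.
Proof. by rewrite /upd => /negbTE ->. Qed.

Ltac upds := repeat match goal with
  | |- context [upd ?r ?i ?v ?i] => rewrite (upd_eq r i v)
  | |- context [upd ?r ?i ?v ?j] =>
      first [rewrite (@upd_ne r i v j isT) | rewrite (@upd_ne r i v j); last lia]
  end.
Ltac vstep :=
  match goal with
  | |- wp (Mov _ _) _ _ => unfold Mov
  | |- wp (_ ;; _) _ _ => apply: wp_seq
  | |- wp (Cst _ _) _ _ => apply: wp_const
  | |- wp (Plus _ _ _) _ _ => apply: wp_add; let v := fresh "v" in move=> v
  | |- wp (Minus _ _ _) _ _ => apply: wp_sub; let v := fresh "v" in move=> v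
  | |- wp (Get _ _) _ _ => apply: wp_load; let v := fresh "v" in move=> v
  | |- wp (Put _ _) _ _ =>
      apply: wp_store; let i := fresh "i" in let v := fresh "v" in move=> i v
  end; upds; cbv beta; repeat (let E := fresh "E" in move=> E).
Ltac vsteps := repeat vstep.

Definition same_except (L : seq nat) (r r' : regs) : Prop :=
  forall j, j \notin L -> r' j = r j.

Lemma same_trans L1 L2 L r r1 r2 :
  same_except L1 r r1 -> same_except L2 r1 r2 ->
  {subset L1 <= L} -> {subset L2 <= L} -> same_except L r r2.
Proof.
move=> F1 F2 s1 s2 j Hj; rewrite F2 ?F1 //; apply: contra Hj; [exact: s1|exact: s2].
Qed.

Ltac sub_list := let j := fresh "j" in move=> j; rewrite !inE; lia.

Ltac frame := let j := fresh "j" in let H := fresh "H" in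
  move=> j H; rewrite !inE ?negb_or in H; upds.

(** Hides the accumulated updates behind a variable; once the needed register values are extracted,
    the defining equation is cleared and later terms stay small. *)
Ltac name_state r1 er1 :=
  match goal with |- wp _ ?s _ =>
    have [r1 er1] : exists r1, r1 = s by exists s
  end; rewrite -er1.

(** * Counting the classes of one tuple *)

(* Registers: 0 |X|, 1 |E|, 2 k, 3 l, 4 scratch of [While], 5 the constant 1,
   6 address of the matrix, 7 length of the tuple, 8 address of the tuple,
   9 acceptance flag, 10 search flag, 11 number of classes, 12 and 14 addresses of
   the two rows compared, 13 and 15 remaining rows, 16 position in the tuple and
   17 remaining length, 18-20 temporaries, 21 zero iff the two traces agree, 22 one
   iff the current trace is new, 23 carry. *)
Definition stored (r : regs) (b : nat) (s : seq nat) : Prop :=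
  forall q, q < size s -> r (b + q) = nth 0 s q.

Lemma stored_cons r b d s :
  stored r b (d :: s) -> r b = d /\ stored r b.+1 s.
Proof.
move=> H; split; first by have := H 0 isT; rewrite addn0.
by move=> q Hq; have := H q.+1 Hq; rewrite addnS.
Qed.

Lemma stored_same L r r' b s :
  same_except L r r' -> (forall j, b <= j -> j \notin L) ->
  stored r b s -> stored r' b s.
Proof. by move=> F HL H q Hq; rewrite F ?H // HL // leq_addr. Qed.

(** With truncated subtraction [(a - b) + (b - a)] is the distance of the two bits; register 21 sums
    these distances and stays zero only while the rows agree. *)
Definition diff_body :=
  Get 18 16 ;; Plus 19 12 18 ;; Get 19 19 ;; Plus 20 14 18 ;; Get 20 20 ;;
  Minus 18 19 20 ;; Plus 21 21 18 ;; Minus 18 20 19 ;; Plus 21 21 18 ;;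
  Plus 16 16 5 ;; Minus 17 17 5.

Definition diff_rows := Cst 21 0 ;; Mov 16 8 ;; Mov 17 7 ;; While 17 diff_body.

(** The bounds [24 <= _] separate the rows and the tuple from the working registers, so the loop
    never overwrites what it reads. A round takes eleven instructions and three for the loop. *)
Lemma diff_loop_spec ts r :
  r 5 = 1 -> 24 <= r 12 -> 24 <= r 14 -> 24 <= r 16 ->
  r 17 = size ts -> stored r (r 16) ts ->
  wp (While 17 diff_body) r (fun t r' =>
    [/\ t <= 14 * size ts + 1,
        (r' 21 == 0) = (r 21 == 0) && all (fun x => r (r 12 + x) == r (r 14 + x)) ts
      & same_except [:: 4; 16; 17; 18; 19; 20; 21] r r']).
Proof.
elim: ts r => [|d ts IH] r h5 h12 h14 h16 h17 hs.
  apply: wp_while => [_|]; last by rewrite h17.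
  by split=> //; rewrite andbT.
apply: wp_while => [|_]; first by rewrite h17.
have [hd hs'] := stored_cons hs.
rewrite /diff_body.
vsteps; name_state r1 er1.
have F : same_except [:: 4; 16; 17; 18; 19; 20; 21] r r1 by rewrite er1; frame.
have e16 : r1 16 = (r 16).+1 by rewrite er1; upds; lia.
have e17 : r1 17 = size ts by rewrite er1; upds; rewrite E9 h17 h5 subn1.
have e21 : (r1 21 == 0) = (r 21 == 0) && (r (r 12 + d) == r (r 14 + d)).
  by rewrite er1; upds; rewrite -hd -E -E0 -E2 -E1 -E3; lia.
have {er1} _ := er1.
apply: wp_conseq.
  apply: IH; rewrite ?e16 ?(F 5) ?(F 12) ?(F 14) //; first lia.
  apply: stored_same F _ hs' => j Hj; rewrite !inE; lia.
move=> t r' [Ht H21 F']; split; first by rewrite /=; lia.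
  rewrite H21 e21 /= -andbA !(F 12) // !(F 14) //; do 2 congr (_ && _).
  by apply: eq_all => x; rewrite !F // !inE; lia.
by apply: same_trans F F' _ _; sub_list.
Qed.

Lemma diff_rows_spec ts r :
  r 5 = 1 -> 24 <= r 12 -> 24 <= r 14 -> 24 <= r 8 ->
  r 7 = size ts -> stored r (r 8) ts ->
  wp diff_rows r (fun t r' =>
    [/\ t <= 14 * size ts + 6,
        (r' 21 == 0) = all (fun x => r (r 12 + x) == r (r 14 + x)) ts
      & same_except [:: 4; 16; 17; 18; 19; 20; 21] r r']).
Proof.
move=> h5 h12 h14 h8 h7 hs; rewrite /diff_rows.
vsteps; name_state r1 er1.
have F : same_except [:: 16; 17; 21] r r1 by rewrite er1; frame.
have e16 : r1 16 = r 8 by rewrite er1; upds; lia.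
have e17 : r1 17 = r 7 by rewrite er1; upds; lia.
have e21 : r1 21 = 0 by rewrite er1; upds.
have {er1} _ := er1.
apply: wp_conseq.
  apply: (@diff_loop_spec ts); rewrite ?e16 ?(F 5) ?(F 12) ?(F 14) ?e17 //.
  apply: stored_same F _ hs => j Hj; rewrite !inE; lia.
move=> t r' [Ht H21 F']; split; first by lia.
  rewrite H21 e21 /= !(F 12) // !(F 14) //.
  by apply: eq_all => x; rewrite !F // !inE; lia.
by apply: same_trans F F' _ _; sub_list.
Qed.

(** [1 - r 21] is one exactly when the traces agree, and then clears the flag in register 22;
    truncation keeps a cleared flag at zero. Adding register 0, the row length, moves on to the next
    row. *)
Definition row_body :=
  diff_rows ;; Minus 18 5 21 ;; Minus 22 22 18 ;; Plus 14 14 0 ;; Minus 15 15 5.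

(** Register 13 counts the rows left, the current one included, so [r 1 - r 13] is the index of the
    current row and the number of earlier rows. *)
Definition row_new :=
  Cst 22 1 ;; Mov 14 6 ;; Minus 15 1 13 ;; While 15 row_body.

Definition same_trace (mem : nat -> nat) (n : nat) (ts : seq nat) (i j : nat) :=
  all (fun x => mem (i * n + x) == mem (j * n + x)) ts.

Definition checker_pre (ts : seq nat) (r : regs) : Prop :=
  [/\ r 5 = 1, 24 <= r 6, 24 <= r 8, r 7 = size ts & stored r (r 8) ts].

Lemma checker_pre_same L ts r r' :
  same_except L r r' -> checker_pre ts r ->
  all (fun j => (8 < j) && (j < 24) || (j == 4)) L -> checker_pre ts r'.
Proof.
move=> F [h5 h6 h8 h7 hs] /allP HL.
have low j : j \in [:: 5; 6; 7; 8] -> r' j = r j.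
  by move=> Hj; apply: F; apply/negP => /HL; move: Hj; rewrite !inE; lia.
split; rewrite ?low //.
by apply: stored_same F _ hs => j Hj; apply/negP => /HL; lia.
Qed.

Definition matrix (r : regs) (x : nat) : nat := r (r 6 + x).

Lemma matrix_same L r r' :
  same_except L r r' -> 24 <= r 6 -> all (fun j => (j < 24) && (j != 6)) L ->
  matrix r' =1 matrix r.
Proof.
move=> F h6 /allP HL x; rewrite /matrix (F 6); last by apply/negP => /HL.
by rewrite F //; apply/negP => /HL; lia.
Qed.

Lemma same_trace_ext mem mem' n ts i j :
  mem =1 mem' -> same_trace mem n ts i j = same_trace mem' n ts i j.
Proof. by move=> H; apply: eq_all => x; rewrite !H. Qed.

Lemma row_loop_spec ts i k s r :
  checker_pre ts r -> r 15 = k -> r 12 = r 6 + i * r 0 ->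
  r 14 = r 6 + s * r 0 -> r 22 <= 1 ->
  wp (While 15 row_body) r (fun t r' =>
    [/\ t <= k * (14 * size ts + 13) + 1,
        r' 22 = r 22 * ~~ has (same_trace (matrix r) (r 0) ts i) (iota s k)
      & same_except [:: 4; 14; 15; 16; 17; 18; 19; 20; 21; 22] r r']).
Proof.
elim: k s r => [|k IH] s r hp h15 h12 h14 h22.
  apply: wp_while => [_|]; last by rewrite h15.
  by split; rewrite ?muln1.
apply: wp_while => [|_]; first by rewrite h15.
case: (hp) => h5 h6 h8 h7 hs.
rewrite /row_body; vstep; apply: wp_conseq.
  by apply: (@diff_rows_spec ts); rewrite // ?h12 ?h14; lia.
move=> t r1 [Ht H21 F1]; vsteps; name_state r2 er2.
have F2 : same_except [:: 4; 14; 15; 18; 22] r1 r2 by rewrite er2; frame.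
have F : same_except [:: 4; 14; 15; 16; 17; 18; 19; 20; 21; 22] r r2.
  by apply: same_trans F1 F2 _ _; sub_list.
have e14 : r2 14 = r2 6 + s.+1 * r2 0.
  by rewrite !(F 6) ?(F 0) // er2; upds; rewrite E1 (F1 14) // (F1 0) // h14 mulSn; lia.
have e15 : r2 15 = k by rewrite er2; upds; rewrite E2 (F1 15) // (F1 5) // h15 h5 subn1.
have e22 : r2 22 = r 22 * ~~ same_trace (matrix r) (r 0) ts i s.
  rewrite er2; upds; rewrite E0 E (F1 5) // (F1 22) // h5.
  have -> : same_trace (matrix r) (r 0) ts i s = (r1 21 == 0).
    by rewrite H21; apply: eq_all => x; rewrite /matrix h12 h14 !addnA.
  lia.
have {er2} _ := er2.
apply: wp_conseq.
  apply: (IH s.+1) => //; first by apply: checker_pre_same F hp _.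
    by rewrite (F 12) // (F 6) // (F 0).
  by rewrite e22; lia.
move=> t' r' [Ht' H22 F']; split; first lia.
  rewrite H22 e22 /= -mulnA; congr (_ * _).
  rewrite (F 0) //.
  have -> : has (same_trace (matrix r2) (r 0) ts i) (iota s.+1 k) =
            has (same_trace (matrix r) (r 0) ts i) (iota s.+1 k).
    by apply: eq_has => j; apply: same_trace_ext; apply: matrix_same F _ _.
  by case: same_trace; case: has.
by apply: same_trans F F' _ _; sub_list.
Qed.

Lemma row_new_spec ts i r :
  checker_pre ts r -> r 1 - r 13 = i -> r 12 = r 6 + i * r 0 ->
  wp row_new r (fun t r' =>
    [/\ t <= i * (14 * size ts + 13) + 6,
        r' 22 = ~~ has (same_trace (matrix r) (r 0) ts i) (iota 0 i)
      & same_except [:: 4; 14; 15; 16; 17; 18; 19; 20; 21; 22] r r']).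
Proof.
move=> hp h13 h12; rewrite /row_new; vsteps; name_state r1 er1.
have F : same_except [:: 14; 15; 22] r r1 by rewrite er1; frame.
have e14 : r1 14 = r 6 by rewrite er1; upds; lia.
have e15 : r1 15 = i by rewrite er1; upds; lia.
have e22 : r1 22 = 1 by rewrite er1; upds.
have {er1} _ := er1.
apply: wp_conseq.
  apply: (@row_loop_spec ts i i 0) => //; first by apply: checker_pre_same F hp _.
  - by rewrite (F 12) // (F 6) // (F 0).
  - by rewrite e14 (F 6) // mul0n addn0.
  by rewrite e22.
move=> t r' [Ht H22 F']; split; first lia.
  rewrite H22 e22 mul1n (F 0) //; congr (nat_of_bool (~~ _)).
  case: hp => _ h6 _ _ _.
  by apply: eq_has => j; apply: same_trace_ext; apply: matrix_same F _ _.
by apply: same_trans F F' _ _; sub_list.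
Qed.

Definition check_body := row_new ;; Plus 11 11 22 ;; Plus 12 12 0 ;; Minus 13 13 5.

Definition check := Cst 11 0 ;; Mov 12 6 ;; Mov 13 1 ;; While 13 check_body.

(** Each class is counted at its first occurrence; [class_count_init] identifies the total with
    [n_classes]. *)
Definition class_count (mem : nat -> nat) (n : nat) (ts : seq nat) (i k : nat) :=
  count (fun i => ~~ has (same_trace mem n ts i) (iota 0 i)) (iota i k).

Lemma class_count_ext mem mem' n ts i k :
  mem =1 mem' -> class_count mem n ts i k = class_count mem' n ts i k.
Proof.
move=> H; apply: eq_count => j; congr (~~ _).
by apply: eq_has => j'; apply: same_trace_ext.
Qed.

Definition check_frame := [:: 4; 11; 12; 13; 14; 15; 16; 17; 18; 19; 20; 21; 22].

Lemma check_loop_spec ts i k r :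
  checker_pre ts r -> r 13 = k -> i + k = r 1 -> r 12 = r 6 + i * r 0 ->
  wp (While 13 check_body) r (fun t r' =>
    [/\ t <= k * (r 1 * (14 * size ts + 13) + 12) + 1,
        r' 11 = r 11 + class_count (matrix r) (r 0) ts i k
      & same_except check_frame r r']).
Proof.
elim: k i r => [|k IH] i r hp h13 h1 h12.
  apply: wp_while => [_|]; last by rewrite h13.
  by split; rewrite ?addn0.
apply: wp_while => [|_]; first by rewrite h13.
case: (hp) => h5 h6 h8 h7 hs.
rewrite /check_body; vstep; apply: wp_conseq.
  by apply: (@row_new_spec ts i); rewrite // ?h12 ?h14; lia.
move=> t r1 [Ht H22 F1]; vsteps; name_state r2 er2.
have F2 : same_except [:: 4; 11; 12; 13] r1 r2 by rewrite er2; frame.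
have F : same_except check_frame r r2 by apply: same_trans F1 F2 _ _; sub_list.
have e12 : r2 12 = r2 6 + i.+1 * r2 0.
  by rewrite !(F 6) ?(F 0) // er2; upds; rewrite E0 (F1 12) // (F1 0) // h12 mulSn; lia.
have e13 : r2 13 = k by rewrite er2; upds; rewrite E1 (F1 13) // (F1 5) // h13 h5 subn1.
have e11 : r2 11 = r 11 + ~~ has (same_trace (matrix r) (r 0) ts i) (iota 0 i).
  by rewrite er2; upds; rewrite E (F1 11) // H22.
have {er2} _ := er2.
apply: wp_conseq.
  apply: (IH i.+1) => //; first by apply: checker_pre_same F hp _.
  by rewrite (F 1) // -h1 addSnnS.
move=> t' r' [Ht' H11 F']; split.
- move: Ht'; rewrite (F 1) //.
  have : i * (14 * size ts + 13) <= r 1 * (14 * size ts + 13) by apply: leq_mul => //; lia.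
  lia.
- rewrite H11 e11 /class_count /= addnA; congr (_ + _); rewrite (F 0) //.
  by apply: class_count_ext; apply: matrix_same F _ _.
by apply: same_trans F F' _ _; sub_list.
Qed.

Lemma check_spec ts r :
  checker_pre ts r ->
  wp check r (fun t r' =>
    [/\ t <= r 1 * (r 1 * (14 * size ts + 13) + 12) + 6,
        r' 11 = class_count (matrix r) (r 0) ts 0 (r 1)
      & same_except check_frame r r']).
Proof.
move=> hp; rewrite /check; vsteps; name_state r1 er1.
have F : same_except [:: 11; 12; 13] r r1 by rewrite er1; frame.
have e12 : r1 12 = r 6 by rewrite er1; upds; lia.
have e13 : r1 13 = r 1 by rewrite er1; upds; lia.
have e11 : r1 11 = 0 by rewrite er1; upds.
have {er1} _ := er1.
apply: wp_conseq.
  apply: (@check_loop_spec ts 0 (r 1)) => //; first by apply: checker_pre_same F hp _.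
  - by rewrite (F 1).
  by rewrite e12 (F 6) // mul0n addn0.
move=> t r' [Ht H11 F']; split.
- by move: Ht; rewrite (F 1) //; lia.
- rewrite H11 e11 add0n (F 0) //; case: hp => _ h6 _ _ _.
  by apply: class_count_ext; apply: matrix_same F _ _.
by apply: same_trans F F' _ _; sub_list.
Qed.

(** * Correctness of the reduction to tuples *)

Lemma exists_intermediate_set (T : finType) (A B : {set T}) k :
  A \subset B -> #|A| <= k <= #|B| ->
  exists D : {set T}, [/\ A \subset D, D \subset B & #|D| = k].
Proof.
move=> sAB; elim: k => [|k IH] /andP[hA hB].
  by exists A; split=> //; apply/eqP; rewrite -leqn0.
case: (leqP #|A| k) => [hk|hk]; last by exists A; split=> //; lia.
have [|D [sAD sDB hD]] := IH; first by rewrite hk ltnW.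
have /properP[_ [x xB xD]] : D \proper B by rewrite properEcard sDB hD.
exists (x |: D); split.
- by apply: subset_trans sAD (subsetUr _ _).
- by rewrite subUset sub1set xB.
by rewrite cardsU1 xD hD.
Qed.

Lemma n_classes_restrict n (E : seq {set 'I_n}) (A B : {set 'I_n}) :
  A \subset B ->
  [set e :&: A | e in E] = [set s :&: A | s in [set e :&: B | e in E]].
Proof.
move=> sAB; rewrite -imset_comp; apply: eq_imset => e /=.
by rewrite -setIA (setIidPr sAB).
Qed.

Lemma n_classes_mono n (E : seq {set 'I_n}) (A B : {set 'I_n}) :
  A \subset B -> n_classes E A <= n_classes E B.
Proof. by move=> sAB; rewrite /n_classes (n_classes_restrict E sAB) leq_imset_card. Qed.

(* Bondy's argument: as long as a trace is lost, one more vertex splits a class. *)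
Lemma few_vertices_suffice n (E : seq {set 'I_n}) (C : {set 'I_n}) l :
  l <= n_classes E C ->
  exists A : {set 'I_n}, [/\ A \subset C, #|A| <= l & l <= n_classes E A].
Proof.
elim: l => [|l IH] hl; first by exists set0; rewrite sub0set cards0.
have [A [sAC hA hlA]] := IH (ltnW hl).
case: (leqP l.+1 (n_classes E A)) => [h|h]; first by exists A; split=> //; lia.
have : ~~ (#|[set e :&: A | e in E]| == #|[set e :&: C | e in E]|).
  by rewrite /n_classes in h hl; lia.
rewrite (n_classes_restrict E sAC) => /imset_injP hinj.
have [/existsP[e1 /existsP[e2 /and4P[he1 he2 /eqP heq hne]]]|] :=
  boolP [exists e1, exists e2, [&& e1 \in E, e2 \in E, e1 :&: A == e2 :&: A
                                 & e1 :&: C != e2 :&: C]]; last first.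
  move=> hno; case: hinj => _ _ /imsetP[e1 he1 ->] /imsetP[e2 he2 ->].
  rewrite -!setIA (setIidPr sAC) => heq; apply/eqP; apply: contraR hno => hne.
  by apply/existsP; exists e1; apply/existsP; exists e2; rewrite he1 he2 heq eqxx.
have [x xC hx] : exists2 x, x \in C & (x \in e1) != (x \in e2).
  apply/exists_inP; apply: contraR hne => /exists_inPn hx.
  apply/eqP/setP => x; rewrite !inE; case xC: (x \in C); rewrite ?andbF // !andbT.
  by apply/eqP; rewrite -[_ == _]negbK; apply: hx.
exists (x |: A); split.
- by rewrite subUset sub1set xC.
- by rewrite cardsU1; lia.
have sAx : A \subset x |: A by rewrite subsetUr.
(* Were the number of classes unchanged, restricting traces from [x |: A] to [A] would be injective,
   but [e1] and [e2] agree on [A] and differ at [x]. *)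
apply: leq_ltn_trans hlA _; rewrite ltn_neqAle n_classes_mono // andbT.
rewrite /n_classes (n_classes_restrict E sAx); apply/imset_injP => inj.
have := inj _ _ (imset_f _ he1) (imset_f _ he2).
rewrite -!setIA (setIidPr sAx) => /(_ heq) /setP /(_ x).
by rewrite !inE eqxx /= !andbT => h'; rewrite h' eqxx in hx.
Qed.

Definition vertex_set n (ts : seq nat) : {set 'I_n} := [set x | val x \in ts].

(** Forwards, Bondy's set of at most [l] vertices is enlarged inside [C] to exactly [minn k l]
    vertices and enumerated. Backwards, the tuple covers at most [k] vertices, and [k <= n] leaves
    room to pad them to [k] without losing classes. *)
Lemma partial_vcE n (E : seq {set 'I_n}) k l :
  partial_vc E k l <->
  k <= n /\ exists ts, [/\ size ts = minn k l, all (fun x => x < n) ts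
                         & l <= n_classes E (vertex_set n ts)].
Proof.
split=> [[C [hC hl]]|[hk [ts [hs hn hl]]]].
  split; first by rewrite -hC -[n in _ <= n]card_ord max_card.
  have [A [sAC hA hlA]] := few_vertices_suffice hl.
  have [|D [sAD sDC hD]] := @exists_intermediate_set _ A C (minn k l) sAC.
    by rewrite -hC geq_minl andbT leq_min hA subset_leq_card.
  exists (map val (enum D)); split.
  - by rewrite size_map -cardE.
  - by apply/allP => x /mapP[y _ ->]; apply: ltn_ord.
  have -> : vertex_set n (map val (enum D)) = D.
    apply/setP => x; rewrite inE mem_map ?mem_enum //; exact: val_inj.
  exact: leq_trans hlA (n_classes_mono _ sAD).
have [|D [sD _ hD]] := @exists_intermediate_set _ (vertex_set n ts) setT k (subsetT _).
  rewrite cardsT card_ord hk andbT.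
  apply: leq_trans (geq_minl k l); rewrite -hs cardsE cardE.
  rewrite -(size_map val); apply: uniq_leq_size.
    by rewrite map_inj_uniq ?enum_uniq //; exact: val_inj.
  by move=> x /mapP[y]; rewrite mem_enum => hy ->.
by exists D; split=> //; apply: leq_trans hl (n_classes_mono _ sD).
Qed.


(** Induction from the right end: the last entry adds one exactly when its image has not occurred
    before, and the tests at earlier positions are unaffected. *)
Lemma card_image_count (T U : finType) (F : T -> U) (x0 : T) (s : seq T) :
  #|[set F x | x in s]| =
  count (fun i => ~~ has (fun j => F (nth x0 s i) == F (nth x0 s j)) (iota 0 i))
        (iota 0 (size s)).
Proof.
elim/last_ind: s => [|s x IH].
  by rewrite /= -(cards0 U); apply: eq_card => y; rewrite inE; apply/imsetP => -[].
rewrite size_rcons -[in RHS]addn1 iotaD count_cat /= add0n addn0.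
rewrite [in X in _ + X]nth_rcons ltnn eqxx.
have -> : has (fun j => F x == F (nth x0 (rcons s x) j)) (iota 0 (size s)) =
          (F x \in [set F x | x in s]).
  apply/hasP/imsetP => [[j]|[y /(nthP x0)[j hj <-] ->]].
    rewrite mem_iota /= add0n nth_rcons => hj; rewrite hj => /eqP ->.
    by exists (nth x0 s j); rewrite ?mem_nth.
  by exists j; rewrite ?mem_iota // nth_rcons hj.
have -> : [set F x | x in rcons s x] = F x |: [set F x | x in s].
  apply/setP => y; rewrite !inE; apply/imsetP/orP => [[z]|[/eqP ->|/imsetP[z hz ->]]].
  - rewrite mem_rcons inE => /orP[/eqP -> ->|hz ->]; first by left.
    by right; apply: imset_f.
  - by exists x; rewrite // mem_rcons mem_head.
  by exists z; rewrite // mem_rcons inE hz orbT.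
rewrite cardsU1 addnC IH; congr (_ + _); apply: eq_in_count => i.
rewrite mem_iota /= add0n => hi; congr (~~ _); apply: eq_in_has => j.
by rewrite mem_iota /= add0n => hj; rewrite !nth_rcons hi (ltn_trans hj hi).
Qed.

Lemma init_regs_matrix n (E : seq {set 'I_n}) k l i (x : 'I_n) :
  i < size E -> init_regs E k l (4 + (i * n + x)) = (x \in nth set0 E i).
Proof.
move=> hi; rewrite /init_regs /= addKn.
have hx := ltn_ord x; have n0 : 0 < n by lia.
have -> : i * n + x < size E * n.
  by apply: (@leq_trans (i.+1 * n)); rewrite ?leq_mul2r ?hi ?orbT // mulSn; lia.
rewrite divnMDl // divn_small // addn0 modnMDl modn_small // /incid.
congr nat_of_bool; apply/existsP/idP => [[y /andP[/eqP hy]]|hxi].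
  by rewrite (val_inj hy).
by exists x; rewrite eqxx.
Qed.

Lemma same_trace_init n (E : seq {set 'I_n}) k l ts i j :
  all (fun x => x < n) ts -> i < size E -> j < size E ->
  same_trace (fun x => init_regs E k l (4 + x)) n ts i j =
  (nth set0 E i :&: vertex_set n ts == nth set0 E j :&: vertex_set n ts).
Proof.
move=> /allP hn hi hj; apply/allP/eqP => [h|/setP h x hx].
  apply/setP => x; rewrite !inE; case hx: (val x \in ts); rewrite ?andbF // !andbT.
  have := h _ hx; rewrite !init_regs_matrix //.
  by do 2 case: (x \in _).
have := h (Ordinal (hn _ hx)); rewrite !inE /= hx !andbT => e.
by rewrite -[x]/(val (Ordinal (hn _ hx))) !init_regs_matrix // e.
Qed.

Lemma class_count_init n (E : seq {set 'I_n}) k l ts :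
  all (fun x => x < n) ts ->
  class_count (fun x => init_regs E k l (4 + x)) n ts 0 (size E) =
  n_classes E (vertex_set n ts).
Proof.
move=> hn; rewrite /n_classes (card_image_count _ set0).
apply: eq_in_count => i; rewrite mem_iota /= add0n => hi; congr (~~ _).
apply: eq_in_has => j; rewrite mem_iota /= add0n => hj.
by apply: same_trace_init => //; apply: ltn_trans hi.
Qed.

(** * The odometer *)

(** The number written in base [n] with the least significant digit first; it measures the progress
    of the odometer. *)
Definition base_val (n : nat) (ts : seq nat) : nat :=
  foldr (fun d v => d + n * v) 0 ts.

Lemma base_val_lt n ts : all (fun x => x < n) ts -> base_val n ts < n ^ size ts.
Proof.
elim: ts => //= d ts IH /andP[hd /IH h]; rewrite expnS.
have : n * (base_val n ts).+1 <= n * n ^ size ts by rewrite leq_mul2l h orbT.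
rewrite mulnS; lia.
Qed.

Lemma base_val_inj n ts ts' :
  size ts = size ts' -> all (fun x => x < n) ts -> all (fun x => x < n) ts' ->
  base_val n ts = base_val n ts' -> ts = ts'.
Proof.
elim: ts ts' => [|d ts IH] [|d' ts'] //= [hs] /andP[hd h] /andP[hd' h'] e.
have ed : d = d'.
  have := congr1 (modn^~ n) e.
  by rewrite ![_ + n * _]addnC ![n * _]mulnC !modnMDl !modn_small.
rewrite -{}ed in e *; congr cons; apply: IH => //; apply/eqP.
by move/addnI/eqP: e; rewrite eqn_pmul2l //; lia.
Qed.

Lemma base_val_nseq n m : base_val n (nseq m 0) = 0.
Proof. by elim: m => //= m ->; rewrite muln0. Qed.

(** For a digit [d], carry included, [1 - (|X| - d)] is one exactly when [d] has reached [|X|]; the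
    digit then wraps to zero and the carry is set again. *)
Definition next_body :=
  Get 18 16 ;; Plus 18 18 23 ;; Cst 23 0 ;; Minus 19 0 18 ;; Minus 19 5 19 ;;
  When 19 (Cst 18 0 ;; Cst 23 1) ;; Put 16 18 ;; Plus 16 16 5 ;; Minus 17 17 5.

Definition next_tuple := Cst 23 1 ;; Mov 16 8 ;; Mov 17 7 ;; While 17 next_body.

Definition next_regs := [:: 4; 16; 17; 18; 19; 23].

(** Schoolbook addition of a carry. An outgoing carry has weight [r 0 ^ size ts], so it signals that
    the odometer has wrapped around. *)
Lemma next_loop_spec ts b r :
  r 5 = 1 -> r 17 = size ts -> r 16 = b -> 24 <= b -> r 23 <= 1 ->
  all (fun x => x < r 0) ts -> stored r b ts ->
  wp (While 17 next_body) r (fun t r' =>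
    t <= 14 * size ts + 1 /\
    (exists ts', [/\ size ts' = size ts, all (fun x => x < r 0) ts', stored r' b ts'
       & base_val (r 0) ts' + r' 23 * r 0 ^ size ts = base_val (r 0) ts + r 23]) /\
    r' 23 <= 1 /\
    (forall j, j \notin next_regs -> ~~ (b <= j < b + size ts) -> r' j = r j)).
Proof.
elim: ts b r => [|d ts IH] b r h5 h17 h16 hb h23 hn hs.
  apply: wp_while => [_|]; last by rewrite h17.
  split=> //; split; last by [].
  by exists [::]; split=> //; rewrite /= muln1.
apply: wp_while => [|_]; first by rewrite h17.
have [hd hs'] := stored_cons hs.
case/andP: hn => hdn hn.
rewrite /next_body; do 10 vstep; vstep.
name_state r1 er1.
have F1 : same_except [:: 18; 19; 23] r r1 by rewrite er1; frame.
have e18 : r1 18 = d + r 23 by rewrite er1; upds; rewrite E0 E h16 hd.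
have e19 : r1 19 = (d + r 23 == r 0).
  rewrite er1; upds; rewrite E2 E1 E0 E h16 hd h5; lia.
have e23 : r1 23 = 0 by rewrite er1; upds.
have {er1} _ := er1.
pose d' := (d + r 23) * (d + r 23 != r 0).
apply: wp_conseq.
  apply: (@wp_when _ _ _ (fun t r2 => [/\ t <= 3, same_except [:: 18; 23] r1 r2,
     r2 18 = d' & r2 23 = (d + r 23 == r 0)])).
    by rewrite e19 /d' => h; split=> //; rewrite ?e18 ?e23; lia.
  rewrite e19 => h; vsteps; split=> //; first by frame.
  - by rewrite /d'; upds; lia.
  by upds; lia.
move=> t r2 [ht F2 f18 f23].
have {F1 F2}F : same_except [:: 18; 19; 23] r r2.
  by apply: same_trans F1 F2 _ _; sub_list.
have f16 : r2 16 = b by rewrite F.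
have {e18 e19 e23} _ := e18.
vstep; vstep; rewrite f16 in E3; rewrite E3.
vsteps; name_state r3 er3.
have G : forall j, j \notin next_regs -> j != b -> r3 j = r j.
  by move=> j hj hjb; rewrite er3; rewrite !inE in hj; upds; rewrite F // !inE; lia.
have g16 : r3 16 = b.+1 by rewrite er3; upds; rewrite E5 f16 (F 5) // h5 addn1.
have g17 : r3 17 = size ts by rewrite er3; upds; rewrite E6 (F 17) // (F 5) // h17 h5 subn1.
have gb : r3 b = d' by rewrite er3; upds; rewrite E4.
have g23 : r3 23 = (d + r 23 == r 0) by rewrite er3; upds.
have {er3} _ := er3.
have g0 : r3 0 = r 0 by rewrite G //; lia.
apply: wp_conseq.
  apply: (IH b.+1) => //; rewrite ?g0 ?g23 //; try lia.
    by rewrite G //; lia.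
  move=> q hq; rewrite G; [exact: hs' | rewrite !inE; lia | lia].
move=> t' r' [ht' [[ts' [hs1 hn1 hst he]] [h23' F']]].
split; first by rewrite /=; lia.
split; last first.
  split=> // j hj hr; rewrite F' ?G //; rewrite /= in hr; lia.
exists (d' :: ts'); rewrite /= hs1; split=> //.
- by rewrite -g0 hn1 andbT g0 /d'; lia.
- case=> [_|q hq]; first by rewrite addn0 /= F' ?gb ?inE //; lia.
  by rewrite addnS -addSn /= hst.
(* The equation for the higher digits is multiplied by the base [r 0]; what remains is whether the
   lowest digit wraps. *)
rewrite g0 g23 in he; rewrite expnS mulnCA -addnA -mulnDr he mulnDr /d'.
case: eqP => [e|_] /=; lia.
Qed.

Lemma next_tuple_spec ts r :
  r 5 = 1 -> r 7 = size ts -> 24 <= r 8 ->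
  all (fun x => x < r 0) ts -> stored r (r 8) ts ->
  wp next_tuple r (fun t r' =>
    t <= 14 * size ts + 6 /\
    (exists ts', [/\ size ts' = size ts, all (fun x => x < r 0) ts', stored r' (r 8) ts'
       & base_val (r 0) ts' + r' 23 * r 0 ^ size ts = base_val (r 0) ts + 1]) /\
    r' 23 <= 1 /\
    (forall j, j \notin next_regs -> ~~ (r 8 <= j < r 8 + size ts) -> r' j = r j)).
Proof.
move=> h5 h7 h8 hn hs; rewrite /next_tuple; vsteps; name_state r1 er1.
have F : same_except [:: 16; 17; 23] r r1 by rewrite er1; frame.
have e16 : r1 16 = r 8 by rewrite er1; upds; lia.
have e17 : r1 17 = size ts by rewrite er1; upds; lia.
have e23 : r1 23 = 1 by rewrite er1; upds.
have {er1} _ := er1.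
have e0 : r1 0 = r 0 by rewrite F.
apply: wp_conseq.
  apply: (@next_loop_spec ts (r 8)) => //; rewrite ?e23 ?e0 //; first by rewrite F.
  by move=> q hq; rewrite F ?hs // !inE; lia.
move=> t r'; rewrite e23 e0 => -[ht [hex [h23 F']]]; split; first lia.
split=> //; split=> // j hj hr; rewrite F' // F //.
by rewrite !inE in hj *; lia.
Qed.

(** * The search *)

(** [1 - (l - count)] is one exactly when the count reaches [l]. The search stops on acceptance or
    on overflow of the odometer; truncation covers the case of both. *)
Definition main_body :=
  check ;; Minus 9 3 11 ;; Minus 9 5 9 ;; Minus 10 5 9 ;; next_tuple ;; Minus 10 10 23.

Definition add_body (d s c : nat) := Plus d d s ;; Minus c c 5.

(** [k - (k - l)] is [minn k l]. The tuple lies right behind the matrix, where the registers are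
    still zero, so it needs no initialisation. For [k > |X|] the search flag is cleared
    beforehand. *)
Definition main :=
  Minus 16 2 3 ;; Minus 7 2 16 ;; Mov 8 6 ;; Mov 17 1 ;; While 17 (add_body 8 0 17) ;;
  Cst 9 0 ;; Cst 10 1 ;; Minus 16 2 0 ;; When 16 (Cst 10 0) ;;
  While 10 main_body ;; Mov 0 9.

Lemma add_loop_spec d s c k r :
  uniq [:: 4; 5; d; s; c] -> r 5 = 1 -> r c = k ->
  wp (While c (add_body d s c)) r (fun t r' =>
    [/\ t = 5 * k + 1, r' d = r d + k * r s, r' c = 0 & same_except [:: 4; d; c] r r']).
Proof.
rewrite /= !inE => hu h5; elim: k r h5 => [|k IH] r h5 hc.
  by apply: wp_while => [_|]; [split; rewrite ?addn0 | rewrite hc].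
apply: wp_while => [|_]; first by rewrite hc.
rewrite /add_body; vsteps; name_state r1 er1.
have F : same_except [:: 4; d; c] r r1 by rewrite er1; frame.
have ec : r1 c = k by rewrite er1; upds; lia.
have ed : r1 d = r d + r s by rewrite er1; upds.
have {er1} _ := er1.
have es : r1 s = r s by rewrite F // !inE; lia.
have e5 : r1 5 = r 5 by rewrite F // !inE; lia.
apply: wp_conseq; first by apply: IH; rewrite ?e5.
move=> t r' [ht hd hc' F']; split=> //; first lia.
  by rewrite hd ed es mulSn addnA.
by apply: same_trans F F' _ _.
Qed.

Lemma class_count_ext_in mem mem' n M ts :
  all (fun x => x < n) ts -> (forall x, x < M * n -> mem x = mem' x) ->
  class_count mem n ts 0 M = class_count mem' n ts 0 M.
Proof.
move=> /allP hn h.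
have hb i x : i < M -> x \in ts -> i * n + x < M * n.
  move=> hi /hn hx; apply: (@leq_trans (i.+1 * n)); last by rewrite leq_mul2r hi orbT.
  by rewrite mulSn; lia.
apply: eq_in_count => i; rewrite mem_iota /= add0n => hi; congr (~~ _).
apply: eq_in_has => j; rewrite mem_iota /= add0n => hj.
by apply: eq_in_all => x hx; rewrite !h // hb // (ltn_trans hj).
Qed.

Definition valid (n m : nat) (ts : seq nat) := size ts = m /\ all (fun x => x < n) ts.

Definition good mem (n M l : nat) (ts : seq nat) := l <= class_count mem n ts 0 M.

Definition main_env (n M l m S : nat) (mem : nat -> nat) (r : regs) : Prop :=
  [/\ r 0 = n /\ r 1 = M, r 3 = l, r 5 = 1 /\ r 6 = S, r 7 = m /\ r 8 = S + M * n
    & forall x, x < M * n -> r (S + x) = mem x].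

(* While the search runs, [f] is the number of tuples not yet rejected. *)
Definition main_inv n M l m S mem (f : nat) (r : regs) : Prop :=
  main_env n M l m S mem r /\
  ((r 10 = 0 /\ (r 9 != 0 <-> exists ts, valid n m ts /\ good mem n M l ts)) \/
   (r 10 = 1 /\ exists ts, [/\ valid n m ts, stored r (S + M * n) ts,
      f + base_val n ts = n ^ m
      & forall ts', valid n m ts' -> base_val n ts' < base_val n ts ->
                    ~~ good mem n M l ts'])).

Lemma main_env_same n M l m S mem L r r' :
  24 <= S -> main_env n M l m S mem r ->
  (forall j, j \notin L -> ~~ (S + M * n <= j < S + M * n + m) -> r' j = r j) ->
  all (fun j => (8 < j) && (j < 24) || (j == 4)) L ->
  main_env n M l m S mem r'.
Proof.
move=> hS [[h0 h1] h3 [h5 h6] [h7 h8] hm] F /allP HL.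
have low j : j \in [:: 0; 1; 3; 5; 6; 7; 8] -> r' j = r j.
  move=> Hj; rewrite !inE in Hj; apply: F; last lia.
  by apply/negP => /HL; lia.
split; rewrite ?low // => x hx; rewrite F ?hm //; last lia.
by apply/negP => /HL; lia.
Qed.

Definition main_body_time M m := M * (M * (14 * m + 13) + 12) + 14 * m + 17.

(** [0 < f] holds because the value of the current tuple is below [n ^ m]; it rules out a running
    loop with no tuple left. *)
Lemma main_body_spec n M l m S mem f r :
  24 <= S -> main_inv n M l m S mem f r -> r 10 != 0 ->
  wp main_body r (fun t r' => [/\ t <= main_body_time M m, 0 < f
     & main_inv n M l m S mem f.-1 (upd r' 4 0)]).
Proof.
move=> hS [he [[-> _ //]|[h10 [ts [[hsz hn] hst hf hno]]]]] _.
case: (he) => -[h0 h1] h3 [h5 h6] [h7 h8] hm.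
have hlt := base_val_lt hn; rewrite hsz in hlt.
rewrite /main_body; vstep; apply: wp_conseq.
  by apply: (@check_spec ts); split=> //; rewrite ?h6 ?h7 ?h8 //; lia.
move=> t1 r1 [ht1 h11 F1]; rewrite h0 h1 in h11.
have {}h11 : r1 11 = class_count mem n ts 0 M.
  by rewrite h11; apply: class_count_ext_in => // x hx; rewrite /matrix h6 hm.
have g3 : r1 3 = l by rewrite F1.
have g5 : r1 5 = 1 by rewrite F1.
do 7 vstep; name_state r2 er2.
have F2 : same_except [:: 9; 10] r1 r2 by rewrite er2; frame.
have {F1 F2}F : same_except [:: 4; 9; 10; 11; 12; 13; 14; 15; 16; 17; 18; 19; 20; 21; 22] r r2.
  by apply: same_trans F1 F2 _ _; sub_list.
have ev : v0 = good mem n M l ts by rewrite E0 E g3 g5 h11 /good; lia.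
have e9 : r2 9 = good mem n M l ts by rewrite er2; upds.
have e10 : r2 10 = ~~ good mem n M l ts.
  by rewrite er2; upds; rewrite E1 ev g5; case: good.
have {er2} _ := er2.
have low j : j \in [:: 0; 1; 3; 5; 6; 7; 8] -> r2 j = r j.
  by move=> hj; rewrite !inE in hj; rewrite F // !inE; lia.
apply: wp_conseq.
  apply: (@next_tuple_spec ts); rewrite ?low ?h0 ?h7 ?h8 //; first lia.
  by apply: stored_same F _ hst => j hj; rewrite !inE; lia.
rewrite !low // h0 h8 hsz => t3 r3 [ht3 [[ts' [hsz' hn' hst' hval]] [h23 F3]]].
have f9 : r3 9 = r2 9 by rewrite F3 //; lia.
have f10 : r3 10 = r2 10 by rewrite F3 //; lia.
vstep; rewrite f10 in E2; split.
- by move: ht1 ht3; rewrite h1 hsz /main_body_time; lia.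
- by lia.
have env3 : main_env n M l m S mem r3.
  apply: (@main_env_same _ _ _ _ _ _ next_regs r2 r3 hS) => //.
  exact: (main_env_same hS he (fun j hj _ => F j hj) isT).
split.
  apply: (@main_env_same _ _ _ _ _ _ [:: 4; 10] r3 _ hS) => //.
  by move=> j hj _; rewrite !inE in hj; upds.
upds; rewrite f9 e9 E2 e10.
case: (boolP (good mem n M l ts)) => hg /=.
  by left; split=> //; split=> // _; exists ts.
case hc: (r3 23) h23 hval => [|[|]] // _; rewrite ?mul0n ?mul1n => hval.
  right; split=> //; exists ts'; split.
  - by [].
  - by move=> q hq; upds; apply: hst'.
  - by lia.
  (* The value has grown by one, so a tuple below the new one is either the tuple just rejected, by
     injectivity of [base_val], or was rejected before. *)
  move=> ts0 h0'; rewrite -[X in _ < X]addn0 hval addn1 ltnS leq_eqVlt => /orP[/eqP he0|].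
    case: (h0') => hs0 hn0.
    by rewrite (@base_val_inj n ts0 ts) // hs0.
  exact: hno.
(* Overflow: [ts] had the largest value below [n ^ m], so every tuple has been rejected. *)
left; split=> //; split=> // -[ts0 [h0' hg0]].
case: (h0') => hs0 hn0; have := base_val_lt hn0; rewrite hs0 => hl0.
have : base_val n ts0 <= base_val n ts by lia.
rewrite leq_eqVlt => /orP[/eqP he0|hl1].
  by rewrite -(@base_val_inj n ts0 ts) ?hg0 // ?hs0 // in hg.
by have := hno _ h0' hl1; rewrite hg0.
Qed.

Lemma main_loop_spec n M l m S mem f r :
  24 <= S -> main_inv n M l m S mem f r ->
  wp (While 10 main_body) r (fun t r' =>
    t <= f * (main_body_time M m + 3) + 1 /\
    (r' 9 != 0 <-> exists ts, valid n m ts /\ good mem n M l ts)).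
Proof.
move=> hS; elim: f r => [|f IH] r hI; (apply: wp_while => [h10|h10];
  first by case: (hI) => _ [[_ H]|[h _]]; [rewrite addn1 | rewrite h in h10]).
  by apply: wp_conseq; [apply: main_body_spec hS hI h10 | move=> t r' []].
apply: wp_conseq; first by apply: main_body_spec hS hI h10.
move=> t r1 [ht _ hI1]; apply: wp_conseq; first exact: IH hI1.
by move=> t' r' [ht' H]; split=> //; lia.
Qed.

(** The zeros behind the matrix supply the initial tuple. The search term is confined to [k <= n],
    since only then is [minn k l], which enters the time of a round, sure to be at most [n]. *)
Lemma main_spec n M k l S mem r :
  24 <= S -> r 0 = n -> r 1 = M -> r 2 = k -> r 3 = l -> r 5 = 1 -> r 6 = S ->
  (forall x, x < M * n -> r (S + x) = mem x) ->
  (forall x, M * n <= x -> r (S + x) = 0) ->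
  wp main r (fun t r' =>
    t <= 5 * M + 30 + (if k <= n then n ^ minn k l * (main_body_time M (minn k l) + 3) else 0)
    /\ (r' 0 != 0 <->
        k <= n /\ exists ts, valid n (minn k l) ts /\ good mem n M l ts)).
Proof.
move=> hS h0 h1 h2 h3 h5 h6 hm hz.
rewrite /main; do 12 vstep; vstep; name_state r1 er1.
have F : same_except [:: 7; 8; 16; 17] r r1 by rewrite er1; frame.
have e7 : r1 7 = minn k l by rewrite er1; upds; lia.
have e8 : r1 8 = S by rewrite er1; upds; lia.
have e17 : r1 17 = M by rewrite er1; upds; lia.
have {er1} _ := er1.
apply: wp_seq; apply: wp_conseq.
  by apply: (@add_loop_spec 8 0 17 M) => //; rewrite F.
rewrite e8 (F 0) // h0 => t1 r2 [ht1 h8 _ F1].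
have f7 : r2 7 = minn k l by rewrite F1.
have {F F1}F : same_except [:: 4; 7; 8; 16; 17] r r2.
  by apply: same_trans F F1 _ _; sub_list.
do 6 vstep; vstep; name_state r3 er3.
have G : same_except [:: 9; 10; 16] r2 r3 by rewrite er3; frame.
have g16 : r3 16 = k - n by rewrite er3; upds; rewrite E3 (F 2) // (F 0) // h2 h0.
have g9 : r3 9 = 0 by rewrite er3; upds.
have g10 : r3 10 = 1 by rewrite er3; upds.
have {er3} _ := er3.
apply: wp_conseq.
  apply: (@wp_when _ _ _ (fun t r4 => [/\ t <= 2, same_except [:: 10] r3 r4
     & r4 10 = (k <= n) /\ r4 9 = 0])); rewrite g16 => h.
    by split=> //; rewrite g10; split=> //; lia.
  vstep; split=> //; first by frame.
  by upds; split=> //; lia.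
move=> t2 r4 [ht2 G' [g10' {}g9]].
have {F G G'}F : same_except [:: 4; 7; 8; 9; 10; 16; 17] r r4 /\ same_except [:: 9; 10; 16] r2 r4.
  have H : same_except [:: 9; 10; 16] r2 r4 by apply: same_trans G G' _ _; sub_list.
  by split=> //; apply: same_trans F H _ _; sub_list.
case: F => F G.
have env : main_env n M l (minn k l) S mem r4.
  split; rewrite ?(F 0) ?(F 1) ?(F 3) ?(F 5) ?(F 6) ?(G 7) ?(G 8) //.
  by move=> x hx; rewrite F ?hm // !inE; lia.
apply: wp_seq; case: (leqP k n) g10' => hkn g10'; last first.
  apply: wp_while => [_|]; last by rewrite g10'.
  vstep; vstep; vstep; split; first lia.
  by upds; rewrite E4 add0n g9; split=> // -[].
apply: wp_conseq.
  apply: (@main_loop_spec n M l (minn k l) S mem (n ^ minn k l)) => //.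
  split=> //; right; split=> //; exists (nseq (minn k l) 0); split.
  - split; first by rewrite size_nseq.
    (* Zero is a legal digit: a non-empty tuple forces [0 < k <= n]. *)
    by rewrite all_nseq; case: (posnP (minn k l)) => //; lia.
  - move=> q; rewrite size_nseq nth_nseq => hq; rewrite hq -addnA F ?hz ?leq_addr //.
    by rewrite !inE; lia.
  - by rewrite base_val_nseq addn0.
  by move=> ts' _; rewrite base_val_nseq.
move=> t3 r5 [ht3 h9]; do 3 vstep; split; first lia.
by upds; rewrite E4 add0n h9; split=> [|[]].
Qed.

(** * Relocating the matrix *)

(** Division by two through repeated subtraction, as long as [r 0 - 1] is positive: the quotient
    collects in register 8 and the lowest bit remains in register 0. *)
Definition halve_body := Minus 0 0 5 ;; Minus 0 0 5 ;; Plus 8 8 5 ;; Minus 7 0 5.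

Definition unpack_bit :=
  Cst 8 0 ;; Minus 7 0 5 ;; While 7 halve_body ;; Put 6 0 ;; Mov 0 8 ;; Plus 6 6 5.

Fixpoint unpack (k : nat) : cmd :=
  if k is k'.+1 then unpack_bit ;; unpack k' else Cst 7 0.

Definition packed (n : nat) (bs : seq nat) : nat := foldr (fun b x => b + 2 * x) n bs.

Lemma halve_loop_spec x b r :
  r 5 = 1 -> r 0 = b + 2 * x -> b <= 1 -> r 7 = r 0 - 1 ->
  wp (While 7 halve_body) r (fun t r' =>
    [/\ t = 7 * x + 1, r' 0 = b, r' 8 = r 8 + x & same_except [:: 0; 4; 7; 8] r r']).
Proof.
elim: x r => [|x IH] r h5 h0 hb h7.
  apply: wp_while => [_|]; last by lia.
  by split; rewrite ?addn0 // h0 addn0.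
apply: wp_while => [|_]; first by lia.
rewrite /halve_body; vsteps; name_state r1 er1.
have F : same_except [:: 0; 4; 7; 8] r r1 by rewrite er1; frame.
have e0 : r1 0 = b + 2 * x by rewrite er1; upds; lia.
have e7 : r1 7 = r1 0 - 1 by rewrite er1; upds; lia.
have e8 : r1 8 = r 8 + 1 by rewrite er1; upds; lia.
have {er1} _ := er1.
apply: wp_conseq; first by by apply: IH => //; rewrite F.
move=> t r' [ht H0 H8 F']; split=> //; try lia.
by apply: same_trans F F' _ _; sub_list.
Qed.

Lemma unpack_bit_spec x b a r :
  r 5 = 1 -> r 0 = b + 2 * x -> b <= 1 -> r 6 = a -> 24 <= a ->
  wp unpack_bit r (fun t r' =>
    [/\ t = 7 * x + 7, r' 0 = x, r' a = b, r' 6 = a.+1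
      & forall j, j \notin [:: 0; 4; 6; 7; 8] -> j != a -> r' j = r j]).
Proof.
move=> h5 h0 hb h6 ha; rewrite /unpack_bit; do 4 vstep; vstep; name_state r1 er1.
have F : same_except [:: 7; 8] r r1 by rewrite er1; frame.
have e7 : r1 7 = r1 0 - 1 by rewrite er1; upds; lia.
have e8 : r1 8 = 0 by rewrite er1; upds.
have {er1} _ := er1.
apply: wp_conseq; first by by apply: (@halve_loop_spec x b) => //; rewrite F.
move=> t r' [ht H0 H8 F'].
have {F F'}F : same_except [:: 0; 4; 7; 8] r r'.
  by apply: same_trans F F' _ _; sub_list.
have h6' : r' 6 = a by rewrite F.
vstep; vstep; rewrite h6' in E0; rewrite E0; vsteps; split.
- by lia.
- by upds; lia.
- by upds; rewrite E1.
- by upds; rewrite E3 h6' (F 5) // h5 addn1.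
move=> j hj hja; rewrite !inE in hj; upds; apply: F; rewrite !inE; lia.
Qed.

Lemma unpack_spec n bs a X r :
  r 5 = 1 -> r 0 = packed n bs -> all (fun b => b <= 1) bs -> r 6 = a -> 24 <= a ->
  r 0 <= X ->
  wp (unpack (size bs)) r (fun t r' =>
    [/\ t <= size bs * (7 * X + 7) + 1, r' 0 = n, r' 6 = a + size bs & stored r' a bs] /\
    forall j, j \notin [:: 0; 4; 6; 7; 8] -> ~~ (a <= j < a + size bs) -> r' j = r j).
Proof.
elim: bs a r => [|b bs IH] a r h5 h0 hb h6 ha hX /=.
  vstep; split; first by split; upds; rewrite ?addn0.
  by move=> j hj _; rewrite !inE in hj; upds.
case/andP: hb => hb hbs; rewrite /= in h0.
apply: wp_seq; apply: wp_conseq.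
  by apply: (@unpack_bit_spec (packed n bs) b a).
move=> t r1 [ht e0 ea e6 F]; apply: wp_conseq.
  apply: (IH a.+1) => //; try lia.
  by rewrite F //; lia.
move=> t' r' [[ht' H0 H6 Hs] F']; split; first split=> //.
- by rewrite h0 in hX; lia.
- by rewrite H6 addSnnS.
- case=> [_|q hq]; first by rewrite addn0 F' ?ea ?inE //; lia.
  by rewrite addnS -addSn Hs.
move=> j hj hr; rewrite F' ?F //; lia.
Qed.

Definition copy_body := Get 7 8 ;; Put 6 7 ;; Plus 8 8 5 ;; Plus 6 6 5 ;; Minus 9 9 5.

(** [src + cnt <= dst] keeps writes away from cells still to be read, and [10 <= src] keeps these
    cells apart from the registers in use. *)
Lemma copy_loop_spec cnt src dst r :
  r 5 = 1 -> r 9 = cnt -> r 8 = src -> r 6 = dst -> 10 <= src -> 24 <= dst ->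
  src + cnt <= dst ->
  wp (While 9 copy_body) r (fun t r' =>
    [/\ t = 8 * cnt + 1, r' 6 = dst + cnt, r' 8 = src + cnt
      & forall j, j < cnt -> r' (dst + j) = r (src + j)] /\
    forall j, j \notin [:: 4; 6; 7; 8; 9] -> ~~ (dst <= j < dst + cnt) -> r' j = r j).
Proof.
elim: cnt src dst r => [|cnt IH] src dst r h5 h9 h8 h6 hsrc hdst hle.
  apply: wp_while => [_|]; last by rewrite h9.
  by split=> //; split; rewrite ?addn0.
apply: wp_while => [|_]; first by rewrite h9.
rewrite /copy_body; do 3 vstep; vstep; rewrite h6 in E0; rewrite E0; vsteps.
name_state r1 er1.
have F j : j \notin [:: 4; 6; 7; 8; 9] -> j != dst -> r1 j = r j.
  by move=> hj hjd; rewrite !inE in hj; rewrite er1; upds.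
have ed : r1 dst = r src by rewrite er1; upds; rewrite E1 E h8.
have e6 : r1 6 = dst.+1 by rewrite er1; upds; lia.
have e8 : r1 8 = src.+1 by rewrite er1; upds; lia.
have e9 : r1 9 = cnt by rewrite er1; upds; lia.
have {er1} _ := er1.
apply: wp_conseq.
  apply: (IH src.+1 dst.+1) => //; try lia.
  by rewrite F //; lia.
move=> t r' [[ht H6 H8 Hc] F']; split; first split.
- by lia.
- by rewrite H6 addSnnS.
- by rewrite H8 addSnnS.
- case=> [_|j hj]; first by rewrite !addn0 F' ?ed ?inE //; lia.
  by rewrite !addnS -!addSn Hc // F ?inE //; lia.
move=> j hj hr; rewrite F' ?F //; lia.
Qed.

(** Packing precedes every loop, since loops destroy register 4. While [|X|] is buried in the packed
    number [P], the new address is taken as [24 + |E| * P], which is beyond the old matrix because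
    [P >= |X|]. Both copy pointers advance equally, so their final difference plus 4 gives this
    address back. *)
Definition relocate :=
  Plus 0 0 0 ;; Plus 0 0 9 ;; Plus 0 0 0 ;; Plus 0 0 8 ;; Plus 0 0 0 ;; Plus 0 0 7 ;;
  Plus 0 0 0 ;; Plus 0 0 6 ;; Plus 0 0 0 ;; Plus 0 0 5 ;; Plus 0 0 0 ;; Plus 0 0 4 ;;
  Cst 5 1 ;; Cst 6 24 ;; Mov 7 1 ;; While 7 (add_body 6 0 7) ;;
  unpack 6 ;;
  Cst 7 4 ;; Mov 8 1 ;; While 8 (add_body 7 0 8) ;;
  Cst 8 10 ;; Minus 9 7 8 ;; While 9 copy_body ;;
  Minus 6 6 8 ;; Cst 7 4 ;; Plus 6 6 7.

Lemma relocate_spec n M r :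
  r 0 = n -> r 1 = M -> (forall j, j < 6 -> r (4 + j) <= 1) ->
  (forall j, 4 + M * n <= j -> r j = 0) ->
  wp relocate r (fun t r' => exists S,
    [/\ t <= 10 * M + 42 * (64 * n + 63) + 8 * (M * n) + 100, 24 <= S, r' 5 = 1, r' 6 = S
      & forall x, r' (S + x) = r (4 + x)] /\
    forall j, j < 4 -> r' j = r j).
Proof.
move=> h0 h1 hb hz; rewrite /relocate.
pose bs := [:: r 4; r 5; r 6; r 7; r 8; r 9].
have hbs : all (fun b => b <= 1) bs.
  by rewrite /= !(hb 0, hb 1, hb 2, hb 3, hb 4, hb 5).
do 33 vstep; apply: wp_seq; name_state r1 er1.
have F : same_except [:: 0; 5; 6; 7] r r1 by rewrite er1; frame.
have e0 : r1 0 = packed n bs by rewrite er1; upds; rewrite /packed /=; lia.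
have e5 : r1 5 = 1 by rewrite er1; upds.
have e6 : r1 6 = 24 by rewrite er1; upds.
have e7 : r1 7 = M by rewrite er1; upds; lia.
have {er1} _ := er1.
have hP1 : n <= packed n bs by rewrite /packed /=; lia.
(* Six doublings of [n], and six bits of total weight at most 63. *)
have hP2 : packed n bs <= 64 * n + 63 by rewrite /packed /=; move: hbs => /=; lia.
have {E E0 E1 E2 E3 E4 E5 E6 E7 E8 E9 E10 E11} _ := E.
apply: wp_conseq; first by apply: (@add_loop_spec 6 0 7 M).
move=> t1 r2 [ht1 f6 _ F1]; rewrite e6 e0 in f6.
set P := packed n bs in e0 f6 hP1 hP2.
have [S eS] : exists S, S = 24 + M * P by exists (24 + M * P).
rewrite -eS in f6.
have hMP : M * n <= M * P by rewrite leq_mul2l hP1 orbT.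
have f0 : r2 0 = P by rewrite F1.
have f5 : r2 5 = 1 by rewrite F1.
have {F F1}F : same_except [:: 0; 4; 5; 6; 7] r r2.
  by apply: same_trans F F1 _ _; sub_list.
apply: wp_seq; apply: wp_conseq.
  apply: (@unpack_spec n bs S (64 * n + 63) r2) => //; rewrite ?f0 //; lia.
rewrite [size bs]/= => t2 r3 [[ht2 g0 g6 gs] G].
have H j : j \notin [:: 0; 4; 5; 6; 7; 8] -> ~~ (S <= j < S + 6) -> r3 j = r j.
  by move=> hj hr; rewrite !inE in hj; rewrite G ?F // !inE; lia.
have g5 : r3 5 = 1 by rewrite G //; lia.
have g1 : r3 1 = M by rewrite H //; lia.
do 6 vstep; apply: wp_seq; name_state r4 er4.
have F4 : same_except [:: 7; 8] r3 r4 by rewrite er4; frame.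
have e7' : r4 7 = 4 by rewrite er4; upds.
have e8' : r4 8 = M by rewrite er4; upds; lia.
have {er4} _ := er4.
apply: wp_conseq; first by apply: (@add_loop_spec 7 0 8 M) => //; rewrite F4.
rewrite e7' (F4 0) // g0 => t3 r5 [ht3 k7 _ F5].
have {F4 F5}F5 : same_except [:: 4; 7; 8] r3 r5.
  by apply: same_trans F4 F5 _ _; sub_list.
do 4 vstep; apply: wp_seq; name_state r6 er6.
have F6 : same_except [:: 8; 9] r5 r6 by rewrite er6; frame.
have k8 : r6 8 = 10 by rewrite er6; upds.
have k9 : r6 9 = 4 + M * n - 10 by rewrite er6; upds; lia.
have {er6} _ := er6.
have {F5 F6}F6 : same_except [:: 4; 7; 8; 9] r3 r6.
  by apply: same_trans F5 F6 _ _; sub_list.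
apply: wp_conseq.
  apply: (@copy_loop_spec (4 + M * n - 10) 10 (S + 6)) => //; try lia.
  - by rewrite F6.
  by rewrite F6.
move=> t4 r7 [[ht4 l6 l8 lc] F7].
have l5 : r7 5 = 1 by rewrite F7 ?F6 //; lia.
vsteps; exists S; split; last first.
  move=> j hj; upds; rewrite F7 ?inE; [|lia|lia].
  rewrite F6; last by rewrite !inE; lia.
  case: (posnP j) => [->|hj0]; first by rewrite g0.
  by rewrite H // ?inE; lia.
split.
- lia.
- lia.
- by upds.
- by upds; lia.
move=> x; upds.
(* The first six cells come from unpacking and the next ones from copying; beyond the matrix both
   sides are zero. *)
case: (ltnP x 6) => hx.
  rewrite F7 ?inE; [|lia|lia].
  rewrite F6 ?inE; last lia.
  rewrite gs //.
  by move: x hx; do 6 case=> //.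
have -> : S + x = S + 6 + (x - 6) by lia.
have -> : 4 + x = 10 + (x - 6) by lia.
case: (ltnP (x - 6) (4 + M * n - 10)) => hx'.
  rewrite lc // F6 ?inE; last lia.
  by rewrite H // ?inE; lia.
rewrite F7 ?inE; [|lia|lia].
rewrite F6 ?inE; last lia.
rewrite H ?inE; [|lia|lia].
by rewrite !hz; lia.
Qed.

(** * The theorem *)

Definition solver : program := compile 0 (relocate ;; main).

Lemma init_regs_le1 n (E : seq {set 'I_n}) k l j : init_regs E k l (4 + j) <= 1.
Proof. by rewrite /init_regs /=; case: ifP => // _; apply: leq_b1. Qed.

Lemma init_regs_out n (E : seq {set 'I_n}) k l j :
  4 + size E * n <= j -> init_regs E k l j = 0.
Proof.
by case: j => [|[|[|[|j]]]] // hj; rewrite /init_regs /= ifF //; lia.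
Qed.

(** The dominant cost of a round, [14 * m * M ^ 2], is cubic in [I] because [m <= n]; hence the
    exponent [m + 3]. The generous constant absorbs relocation and setup. *)
Lemma solver_time n M m I :
  n <= I -> M <= I -> m <= n -> 0 < I ->
  10 * M + 42 * (64 * n + 63) + 8 * (M * n) + 100 +
    (5 * M + 30 + n ^ m * (main_body_time M m + 3)) <= 100 * 100 * I ^ (m + 3).
Proof.
move=> hn hM hm hI; rewrite expnD.
have hp : 0 < I ^ m by rewrite expn_gt0 hI.
(* 73 is the coefficient sum [14 + 13 + 12 + 14 + 17 + 3], lower powers of [I] being bounded by its
   cube. *)
have hbody : main_body_time M m + 3 <= 73 * I ^ 3.
  have hmI := leq_trans hm hn.
  have h1 : M * (14 * m + 13) <= I * (14 * I + 13) by apply: leq_mul => //; lia.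
  have h2 : M * (M * (14 * m + 13) + 12) <= I * (I * (14 * I + 13) + 12).
    by apply: leq_mul => //; lia.
  have h3 : I <= I * I by rewrite leq_pmulr.
  have h4 : I * I <= I * I * I by rewrite leq_pmulr.
  by rewrite /main_body_time -[I ^ 3]/(I * (I * I)); lia.
have hnm : n ^ m <= I ^ m by case: m {hm hp hbody} => // m; rewrite leq_exp2r.
have hmain := leq_mul hnm hbody.
have hMn : M * n <= I * I by apply: leq_mul.
have h3 : I <= I * I by rewrite leq_pmulr.
have h4 : I * I <= I ^ 3 by rewrite -[I ^ 3]/(I * (I * I)) leq_pmull.
have h5 : I ^ 3 <= I ^ m * I ^ 3 by rewrite leq_pmull.
lia.
Qed.

Lemma solver_correct :
  decides_within solver
    (fun n E k l => 100 * 100 * (maxn 2 (inst_size E)) ^ (minn k l + 3)).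
Proof.
move=> n E k l; set T := _ * _.
have [t [r [hrun [ht hr]]]] : wp (relocate ;; main) (init_regs E k l)
    (fun t r => t <= T /\ (r 0 != 0 <-> partial_vc E k l)).
  apply: wp_seq; apply: wp_conseq.
    apply: (@relocate_spec n (size E)) => // [j _|j]; first exact: init_regs_le1.
    exact: init_regs_out.
  move=> t1 r1 [S [[ht1 hS h5 h6 hmat] hlow]].
  apply: wp_conseq.
    apply: (@main_spec n (size E) k l S (fun x => init_regs E k l (4 + x))) => //.
    1-4: by rewrite hlow.
    by move=> x hx; rewrite hmat init_regs_out // leq_add2l.
  move=> t2 r2 [ht2 ->]; split; last first.
    rewrite partial_vcE; split=> -[hk [ts]].
      by move=> [[hs hn] hg]; split=> //; exists ts; rewrite -(class_count_init E k l).
    move=> [hs hn hg]; split=> //; exists ts; split=> //.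
    by rewrite /good class_count_init.
  have hI : n <= maxn 2 (inst_size E) by rewrite /inst_size; lia.
  have hM : size E <= maxn 2 (inst_size E) by rewrite /inst_size; lia.
  have hI0 : 0 < maxn 2 (inst_size E) by lia.
  apply: leq_trans (leq_add ht1 ht2) _.
  case: (leqP k n) => hk; rewrite /T.
    by apply: solver_time => //; apply: leq_trans (geq_minl k l) hk.
  (* For [k > n] no tuple is searched, so the bound with exponent parameter 0 suffices. *)
  apply: leq_trans (leq_trans (solver_time hI hM (leq0n n) hI0) _).
    by rewrite leq_add2l leq_add2l.
  by rewrite leq_mul2l leq_pexp2l // leq_add2r.
exists r; split=> //; exact: compile_exec hrun ht.
Qed.

Theorem theorem4 :
  (exists (p : program) (a c : nat),
     decides_within p
       (fun n E k l => a * (maxn 2 (inst_size E)) ^ (minn k l + c)))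
  /\ in_XP (fun n E k l => k)
  /\ in_XP (fun n E k l => l).
Proof.
have weaken (T T' : forall n, seq {set 'I_n} -> nat -> nat -> nat) p :
    (forall n (E : seq {set 'I_n}) k l, T n E k l <= T' n E k l) ->
    decides_within p T -> decides_within p T'.
  move=> h hp n E k l; have [r [hr hiff]] := hp n E k l.
  by exists r; split=> //; apply: exec_mono hr _.
(* As [100 * 100 <= 2 ^ 14] and the base is at least 2, the constant is absorbed by 14 further
   powers; with the 3 already present this makes 17. *)
have bound (I m d : nat) : 1 < I -> m <= d -> 100 * 100 * I ^ (m + 3) <= I ^ (d + 17).
  move=> hI hm; have -> : d + 17 = 14 + (d + 3) by lia.
  rewrite [I ^ (14 + _)]expnD.
  have h14 : 100 * 100 <= I ^ 14 by apply: (@leq_trans (2 ^ 14)); rewrite ?leq_exp2r.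
  apply: (leq_mul h14); rewrite leq_pexp2l ?leq_add2r //; exact: ltnW.
split; first by exists solver, (100 * 100), 3; apply: solver_correct.
split; exists solver, (fun d => d + 17); apply: weaken solver_correct => n E k l.
  by apply: bound; rewrite ?leq_maxl ?geq_minl.
by apply: bound; rewrite ?leq_maxl ?geq_minr.
Qed.
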